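(* Let $X=(X_s)_{s\in[0,T]}$ be a centered continuous Gaussian process, let $A\subset C([0,T])^*$ be a finite set of conditions, and let $H$ be a separable Hilbert space and $u:H\to C([0,T])$ a linear bounded operator such that for every orthonormal basis $(h_i)_{i=1}^\infty$ of $H$ one has $X=\sum_{i=1}^\infty \omega_i\,(uh_i)$ in distribution, the series converging almost surely in $C([0,T])$, where $(\omega_i)_{i\ge1}$ are independent standard normal random variables. Let $H^{(A)}=\{h\in H: a(uh)=0\text{ for all }a\in A\}$ and let $(f_i)_{i=1}^\infty$ be an orthonormal basis of $H^{(A)}$. Then the process $$X^{(A)}=\sum_{i=1}^\infty \omega_i\,(uf_i)$$ is a conditioned process of $X$ with respect to $A$; that is, its law on $C([0,T])$ equals $\mathbb P_X^{(A)}$.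
   Context: $C([0,T])$ is the Banach space of continuous real functions on $[0,T]$ with the supremum norm, $\mathcal C$ its Borel $\sigma$-algebra. Elements $a\in C([0,T])^*$ are identified with finite signed Borel measures on $[0,T]$, $a(f)=\int f\,da$. A condition is an element of $C([0,T])^*$. $\mathbb P_X$ is the law of $X$ on $(C([0,T]),\mathcal C)$. The conditioned law $\mathbb P_X^{(A)}(F)=\mathbb P_X\big(F\mid \bigcap_{a\in A}a^{-1}(0)\big)$ is the probability measure on $(C([0,T]),\mathcal C)$ determined as follows: for all $b_1,\dots,b_n\in C([0,T])^*$, the joint law of $(b_1,\dots,b_n)$ under $\mathbb P_X^{(A)}$ is the conditional law of the Gaussian vector $(b_1(X),\dots,b_n(X))$ given $a(X)=0$ for all $a\in A$, in the sense of Gaussian conditioning by orthogonal projection, i.e. the law of the vector of differences $b_k(X)-\mathbb E[b_k(X)\mid a(X),a\in A]$, $1\le k\le n$. This prescribes $\mathbb P_X^{(A)}$ on the ring of sets belonging to $\sigma\{b_1,\dots,b_n\}$ for some $b_1,\dots,b_n\in C([0,T])^*$, and it extends uniquely to $\mathcal C$. A continuous Gaussian process is called a conditioned process of $X$ with respect to $A$ if its law on $(C([0,T]),\mathcal C)$ is $\mathbb P_X^{(A)}$. *)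

(* Defs.v *)
From HB Require Import structures.
From mathcomp Require Import all_boot all_order all_algebra finmap.
From mathcomp Require Import all_classical all_reals all_analysis.

Set Implicit Arguments.
Unset Strict Implicit.
Unset Printing Implicit Defensive.

Import Order.TTheory GRing.Theory Num.Theory.
Import numFieldNormedType.Exports.

Local Open Scope classical_set_scope.
Local Open Scope ring_scope.

Section continuous_function_space.
Variables (R : realType) (T : R).

Definition timeInterval : topologicalType := set_type (`[0, T]%classic : set R).

Definition contFun : Type := continuousType timeInterval R.

HB.instance Definition _ := gen_eqMixin contFun.
HB.instance Definition _ := gen_choiceMixin contFun.

Implicit Types f g h : contFun.

Definition mkContFun (f : timeInterval -> R) (cf : continuous f) : contFun :=
  mkcts cf.

Lemma contFunP f g : (forall t, f t = g t) -> f = g.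
Proof. by move=> fg; apply/continuousEP. Qed.

Let cts f : continuous (f : timeInterval -> R).
Proof. exact: cts_fun. Qed.

Lemma contFun_add_subproof f g : continuous (fun t : timeInterval => f t + g t).
Proof. by move=> t; apply: (@continuousD R R timeInterval);
  [exact: (@cts f)|exact: (@cts g)]. Qed.

Lemma contFun_opp_subproof f : continuous (fun t : timeInterval => - f t).
Proof. by move=> t; apply: (@continuousN R R timeInterval); exact: (@cts f). Qed.

Lemma contFun_scale_subproof (c : R) f :
  continuous (fun t : timeInterval => c * f t).
Proof. by move=> t; apply: (@continuousM R timeInterval);
  [exact: cst_continuous|exact: (@cts f)]. Qed.

Lemma contFun_zero_subproof : continuous (fun _ : timeInterval => 0 : R).
Proof. exact: cst_continuous. Qed.

Definition contFun_zero : contFun := mkContFun contFun_zero_subproof.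
Definition contFun_add f g : contFun := mkContFun (@contFun_add_subproof f g).
Definition contFun_opp f : contFun := mkContFun (@contFun_opp_subproof f).
Definition contFun_scale (c : R) f : contFun :=
  mkContFun (@contFun_scale_subproof c f).

Let addA : associative contFun_add.
Proof. by move=> f g h; apply: contFunP => t; exact: addrA. Qed.
Let addC : commutative contFun_add.
Proof. by move=> f g; apply: contFunP => t; exact: addrC. Qed.
Let add0 : left_id contFun_zero contFun_add.
Proof. by move=> f; apply: contFunP => t; exact: add0r. Qed.
Let addN : left_inverse contFun_zero contFun_opp contFun_add.
Proof. by move=> f; apply: contFunP => t; exact: addNr. Qed.

HB.instance Definition _ :=
  GRing.isZmodule.Build contFun addA addC add0 addN.

Let scaleA a b f :
  contFun_scale a (contFun_scale b f) = contFun_scale (a * b) f.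
Proof. by apply: contFunP => t; exact: mulrA. Qed.
Let scale1 : left_id 1 contFun_scale.
Proof. by move=> f; apply: contFunP => t; exact: mul1r. Qed.
Let scaleDr : right_distributive contFun_scale +%R.
Proof. by move=> a f g; apply: contFunP => t; exact: mulrDr. Qed.
Let scaleDl f : {morph contFun_scale^~ f : a b / a + b}.
Proof. by move=> a b; apply: contFunP => t; exact: mulrDl. Qed.

HB.instance Definition _ :=
  GRing.Zmodule_isLmodule.Build R contFun scaleA scale1 scaleDr scaleDl.

Lemma contFunD f g t : (f + g) t = f t + g t. Proof. by []. Qed.
Lemma contFunZ (c : R) f t : (c *: f) t = c * f t. Proof. by []. Qed.

Definition supNorm f : R := sup (range (fun t : timeInterval => `|f t|)).

Lemma contFun_bounded f : has_ubound (range (fun t : timeInterval => `|f t|)).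
Proof.
have cf : {within `[0, T]%classic, continuous (valL_ 0 (f : timeInterval -> R))}.
  exact/subspace_valL_continuousP'/(@cts f).
have /compact_bounded[M [_ /(_ (M + 1))]] :=
  continuous_compact cf (@segment_compact R 0 T).
rewrite ltrDl => /(_ ltr01) fM; exists (M + 1) => _ [t _ <-].
apply: fM; exists (\val t); first exact: set_valP.
by rewrite -[in RHS](@valLK _ _ 0 _ (f : timeInterval -> R)).
Qed.

Lemma le_supNorm f t : `|f t| <= supNorm f.
Proof. by apply: ub_le_sup; [exact: contFun_bounded|exists t]. Qed.

Lemma supNorm_le f (M : R) : 0 <= M -> (forall t, `|f t| <= M) ->
  supNorm f <= M.
Proof.
move=> M0 fM; rewrite /supNorm; set S := (X in sup X).
have [->|/set0P S0] := eqVneq S set0; first by rewrite sup0.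
by apply: ge_sup => // _ [t _ <-].
Qed.

Lemma supNorm_ge0 f : 0 <= supNorm f.
Proof.
rewrite /supNorm; set S := (X in sup X).
have [->|/set0P [_ [t _ _]]] := eqVneq S set0; first by rewrite sup0.
exact: le_trans (le_supNorm f t).
Qed.

Let supNormD f g : supNorm (f + g) <= supNorm f + supNorm g.
Proof.
apply: supNorm_le => [|t]; first by rewrite addr_ge0 ?supNorm_ge0.
rewrite contFunD; apply: le_trans (ler_normD _ _) _.
by rewrite lerD ?le_supNorm.
Qed.

Let supNormZ (c : R) f : supNorm (c *: f) = `|c| * supNorm f.
Proof.
have le (d : R) g : supNorm (d *: g) <= `|d| * supNorm g.
  apply: supNorm_le => [|t]; first by rewrite mulr_ge0 ?supNorm_ge0.
  by rewrite contFunZ normrM ler_wpM2l ?le_supNorm.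
apply/eqP; rewrite eq_le le/=; have [->|c0] := eqVneq c 0.
  by rewrite normr0 mul0r supNorm_ge0.
rewrite -ler_pdivlMl ?normr_gt0// -normfV.
by have := le c^-1 (c *: f); rewrite scalerA mulVf// scale1r.
Qed.

Let supNorm_eq0 f : supNorm f = 0 -> f = 0.
Proof.
move=> f0; apply: contFunP => t; apply/eqP.
by rewrite -normr_le0 -f0 le_supNorm.
Qed.

HB.instance Definition _ :=
  Lmodule_isNormed.Build R contFun supNormD supNormZ supNorm_eq0.

HB.instance Definition _ := @isMeasurable.Build
  (sigma_display (@open contFun)) contFun <<s (@open contFun) >>
  (@sigma_algebra0 _ setT _) (@sigma_algebraC _ _) (@sigma_algebra_bigcup _ setT _).

End continuous_function_space.

Section functional_analysis.
Context {R : realType}.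

Definition dualSpace (V : normedModType R) : set (V -> R) :=
  [set a : V -> R | scalar a /\ continuous a].

Definition bounded_operator (V W : normedModType R) (u : V -> W) : Prop :=
  exists M : R, forall x, `|u x| <= M * `|x|.

(* [ip] is a (real) inner product inducing the norm of [H]; a complete [H]
   with such an [ip] is a real Hilbert space. *)
Definition inner_product (H : normedModType R) (ip : H -> H -> R) : Prop :=
  [/\ forall x y, ip x y = ip y x,
      forall y, scalar (ip ^~ y) &
      forall x, ip x x = `|x| ^+ 2].

Definition separable (V : topologicalType) : Prop :=
  exists D : set V, countable D /\ dense D.

(* The sequence is indexed by all of nat, as in (e_i)_{i=1}^oo, so a
   finite-dimensional subspace has no basis in this sense. *)
Definition orthonormal_basis (H : normedModType R) (ip : H -> H -> R)
    (V : set H) (e : nat -> H) : Prop :=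
  [/\ forall i, V (e i),
      forall i j, ip (e i) (e j) = (i == j)%:R &
      V `<=` closure [set x | exists n (c : nat -> R),
                                x = \sum_(i < n) c i *: e i]].

Definition conditioned_subspace (V : Type) (W : Type) (u : V -> W)
    (A : set (W -> R)) : set V :=
  [set h | forall a, A a -> a (u h) = 0].

End functional_analysis.
Arguments dualSpace {R} V _.

Section probability.
Context {R : realType}.

(* N(m, s^2); [normal_prob m 0] is a junk value, not the Dirac mass. *)
Definition gaussian_prob (m s : R) : set R -> \bar R :=
  if s == 0 then \d_m else normal_prob m s.

Section probability_space.
Context {d : measure_display} {Omega : measurableType d}.
Variable P : probability Omega R.

Definition gaussian_rv (Y : Omega -> R) : Prop :=
  measurable_fun setT Y /\
  exists m s : R, forall B : set R, measurable B ->
    P (Y @^-1` B) = gaussian_prob m s B.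

(* Gaussian vectors are the vectors all of whose linear combinations are
   Gaussian. *)
Definition gaussian_process (T : R) (X : Omega -> contFun T) : Prop :=
  forall (n : nat) (t : 'I_n -> timeInterval T) (c : 'I_n -> R),
    gaussian_rv (fun w => \sum_(k < n) c k * X w (t k)).

Definition centered_process (T : R) (X : Omega -> contFun T) : Prop :=
  forall t : timeInterval T, 'E_P[fun w => X w t]%E = 0%E.

Definition independent_rvs (om : nat -> Omega -> R) : Prop :=
  forall (J : {fset nat}) (B : nat -> set R), (forall i, measurable (B i)) ->
    P (\bigcap_(i in [set` J]) om i @^-1` B i) =
    (\prod_(i <- J) P (om i @^-1` B i))%E.

Definition iid_standard_normal (om : nat -> {mfun Omega >-> R}) : Prop :=
  independent_rvs om /\
  forall i (B : set R), measurable B ->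
    distribution P (om i) B = normal_prob 0 1 B.

Definition as_sum (V : normedModType R) (om : nat -> Omega -> R)
    (v : nat -> V) (Y : Omega -> V) : Prop :=
  {ae P, forall w, series (fun i => om i w *: v i) @ \oo --> Y w}.

(* [Z] is a version of E[Y | G], for a sub-sigma-algebra [G]. *)
Definition cond_expectation (G : set (set Omega)) (Y Z : Omega -> R) : Prop :=
  [/\ P.-integrable setT (EFin \o Y),
      P.-integrable setT (EFin \o Z),
      forall B : set R, measurable B -> G (Z @^-1` B) &
      forall S, G S ->
        (\int[P]_(w in S) (Z w)%:E = \int[P]_(w in S) (Y w)%:E)%E].

(* The sigma-algebra on [Omega] generated by the variables a(X), a in A. *)
Definition conditions_sigma (E : Type) (A : set (E -> R)) (X : Omega -> E) :
    set (set Omega) :=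
  <<s \bigcup_(a in A) preimage_set_system setT (a \o X)
                         (measurable : set (set R)) >>.

(* [Q] is P_X^(A): the joint law under [Q] of any (b_1, ..., b_n) is the law
   under [P] of the vector b_k(X) - E[b_k(X) | a(X), a in A]. *)
Definition conditioned_law (T : R) (X : Omega -> contFun T)
    (A : set (contFun T -> R)) (Q : probability (contFun T) R) : Prop :=
  forall (n : nat) (b : 'I_n -> contFun T -> R),
    (forall k, dualSpace (contFun T) (b k)) ->
    exists Z : 'I_n -> Omega -> R,
      (forall k,
         cond_expectation (conditions_sigma A X) (b k \o X) (Z k)) /\
      forall B : set (n.-tuple R), measurable B ->
        Q [set x | B [tuple b k x | k < n]] =
        P [set w | B [tuple b k (X w) - Z k w | k < n]].

End probability_space.

Definition conditioned_process {d d' : measure_display}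
    {Omega : measurableType d} {Omega' : measurableType d'}
    (P : probability Omega R) (P' : probability Omega' R) (T : R)
    (X : Omega -> contFun T) (A : set (contFun T -> R))
    (Y : {mfun Omega' >-> contFun T}) : Prop :=
  gaussian_process P' Y /\ conditioned_law P X A (distribution P' Y).

End probability.

(* Main.v *)
(** Completing [f] by an orthonormal basis of the orthogonal complement of
    H^(A), which is finite dimensional, gives an orthonormal basis [h] of [H]
    with [h (k + i) = f i].  In the corresponding representation
    X = sum_(i < k) om_i u(h_i) + sum_i om_(k+i) u(f_i) the conditions only see
    the first part.  The second part has the law of sum_i om_i u(f_i), as the
    sequences [om] and [om (k + _)] have the same law.  For a functional [b] one
    finds a combination z of the conditions which agrees with [b] on the first
    part, so that (b - z)(X) has the law of [b] of the second part, and
    z(X) = E[b(X) | a(X), a in A]: the representation obtained from the basis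
    where each [f i] is replaced by [- f i] shows that (b - z)(X) and
    - (b - z)(X) have the same joint law with the conditions.  Finally, every
    functional of [X] is Gaussian, since one may choose a basis whose first
    vector is proportional to its Riesz representer. *)
Require Import Defs.
From HB Require Import structures.
From mathcomp Require Import all_boot all_order all_algebra finmap.
From mathcomp Require Import all_classical all_reals all_analysis.
From mathcomp Require Import measurable_realfun ring lra.

Set Implicit Arguments.
Unset Strict Implicit.
Unset Printing Implicit Defensive.

Import Order.TTheory GRing.Theory Num.Theory.
Import numFieldNormedType.Exports.
Local Open Scope classical_set_scope.
Local Open Scope ring_scope.

(** * Orthonormal bases in Hilbert spaces *)

Section inner_product_theory.
Context {R : realType} {H : completeNormedModType R} {ip : H -> H -> R}.
Hypothesis ipP : inner_product ip.

Lemma ipC x y : ip x y = ip y x. Proof. by case: ipP. Qed.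

Lemma ipxx x : ip x x = `|x| ^+ 2. Proof. by case: ipP. Qed.

Lemma ip0l y : ip 0 y = 0.
Proof.
case: ipP => _ /(_ y) L _; have := L (-1) 0 0.
by rewrite scaler0 addr0 mulN1r addNr.
Qed.

Lemma ipDl x y z : ip (x + y) z = ip x z + ip y z.
Proof. by case: ipP => _ /(_ z) L _; have := L 1 x y; rewrite scale1r mul1r. Qed.

Lemma ipZl a x z : ip (a *: x) z = a * ip x z.
Proof.
by case: ipP => _ /(_ z) L _; have := L a x 0; rewrite addr0 ip0l addr0.
Qed.

Lemma ipNl x z : ip (- x) z = - ip x z.
Proof. by rewrite -scaleN1r ipZl mulN1r. Qed.

Lemma ipBl x y z : ip (x - y) z = ip x z - ip y z.
Proof. by rewrite ipDl ipNl. Qed.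

Lemma ip_suml (I : Type) (r : seq I) (Q : pred I) (F : I -> H) z :
  ip (\sum_(i <- r | Q i) F i) z = \sum_(i <- r | Q i) ip (F i) z.
Proof. by apply: (big_morph (ip^~ z)) => [x y|]; [exact: ipDl|exact: ip0l]. Qed.

Lemma ipDr x y z : ip x (y + z) = ip x y + ip x z.
Proof. by rewrite ![ip x _]ipC ipDl. Qed.
Lemma ipZr a x z : ip x (a *: z) = a * ip x z.
Proof. by rewrite ![ip x _]ipC ipZl. Qed.
Lemma ipNr x z : ip x (- z) = - ip x z.
Proof. by rewrite ![ip x _]ipC ipNl. Qed.
Lemma ipBr x y z : ip x (y - z) = ip x y - ip x z.
Proof. by rewrite ipDr ipNr. Qed.
Lemma ip_sumr (I : Type) (r : seq I) (Q : pred I) (F : I -> H) z :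
  ip z (\sum_(i <- r | Q i) F i) = \sum_(i <- r | Q i) ip z (F i).
Proof. by rewrite ipC ip_suml; under eq_bigr do rewrite ipC. Qed.

Lemma ipxx_eq0 x : ip x x = 0 -> x = 0.
Proof. by rewrite ipxx => /eqP; rewrite sqrf_eq0 normr_eq0 => /eqP. Qed.

Lemma ip_polar x y : ip x y = (`|x + y| ^+ 2 - `|x - y| ^+ 2) / 4.
Proof. by rewrite -!ipxx !(ipDl, ipDr, ipNl, ipNr) (ipC y x); field. Qed.

(** By polarization the inner product is a quadratic expression in norms, so its continuity reduces
    to that of the norm. *)
Lemma cvg_ip (I : Type) (F : set_system I) {FF : Filter F} (g : I -> H) x z :
  g @ F --> x -> ip (g i) z @[i --> F] --> ip x z.
Proof.
move=> gx; rewrite ip_polar; under eq_fun do rewrite ip_polar.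
apply: cvgM; last exact: cvg_cst.
by apply: cvgB; rewrite ?expr2; apply: cvgM; apply: cvg_norm;
  (apply: cvgD || apply: cvgB) => //; exact: cvg_cst.
Qed.

Definition span_closure (e : nat -> H) : set H :=
  closure [set x | exists n (c : nat -> R), x = \sum_(i < n) c i *: e i].

Lemma cvg_span_closure (e : nat -> H) (c : nat -> R) x :
  series (fun i => c i *: e i) @ \oo --> x -> span_closure e x.
Proof.
move=> cx B /cx [N _ NB]; exists (series (fun i => c i *: e i) N).
by split; [exists N, c; rewrite /series/= big_mkord|apply: NB => /=].
Qed.

(** The map [ip^~ z] vanishes on the span and is continuous, hence vanishes on the closure. *)
Lemma ip_span_closure (e : nat -> H) x z :
  (forall i, ip (e i) z = 0) -> span_closure e x -> ip x z = 0.
Proof.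
move=> ez ex; apply/eqP; rewrite -normr_le0; apply/ler_addgt0Pr => _/posnumP[r].
rewrite add0r; pose q y := ip y z.
have qc : q @ x --> q x by apply: cvg_ip; exact: cvg_id.
have [y [[n [c yE]] By]] := ex _ (qc _ (nbhsx_ballx (q x) r%:num (gt0 r))).
have qy : q y = 0.
  by rewrite /q yE ip_suml big1// => i _; rewrite ipZl ez mulr0.
have : ball (q x) r%:num (q y) by exact: By.
by rewrite qy -ball_normE/= subr0 => /ltW.
Qed.

Definition orthonormal (e : nat -> H) := forall i j, ip (e i) (e j) = (i == j)%:R.

Lemma ip_orthonormal_sum e m n (c : nat -> R) j : orthonormal e ->
  ip (\sum_(m <= i < n) c i *: e i) (e j) = if (m <= j < n)%N then c j else 0.
Proof.
move=> oe; rewrite ip_suml.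
under eq_bigr do rewrite ipZl oe.
case: ifPn => mjn.
  rewrite (bigD1_seq j)/= ?mem_index_iota ?iota_uniq// eqxx mulr1.
  by rewrite big1 ?addr0// => i /negbTE ->; rewrite mulr0.
rewrite big_nat big1// => i imn; case: eqP => [ij|]; rewrite ?mulr0//.
by move: mjn; rewrite -ij imn.
Qed.

Lemma norm_orthonormal_sum e m n (c : nat -> R) : orthonormal e ->
  `|\sum_(m <= i < n) c i *: e i| ^+ 2 = \sum_(m <= i < n) c i ^+ 2.
Proof.
move=> oe; rewrite -ipxx ip_sumr big_nat [RHS]big_nat; apply: eq_bigr => i imn.
by rewrite ipZr ip_orthonormal_sum// imn expr2.
Qed.

(** Riesz-Fischer: by Pythagoras the Cauchy criterion for the vector series is that for the real
    series of squares, which is nondecreasing and bounded. *)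
Lemma orthonormal_series_cvg e (c : nat -> R) (M : R) : orthonormal e ->
  (forall n, \sum_(0 <= i < n) c i ^+ 2 <= M) ->
  cvgn (series (fun i => c i *: e i)).
Proof.
move=> oe cM; apply: cauchy_cvg; apply/cauchy_seriesP => r r0.
have : cvgn (series (fun i => c i ^+ 2)).
  apply: nondecreasing_is_cvgn; last by exists M => _ [n _ <-]; exact: cM.
  by apply: nondecreasing_series => n _ _; exact: sqr_ge0.
move=> /cauchy_cvgP/cauchy_seriesP/(_ (r ^+ 2)); rewrite exprn_gt0// => /(_ isT).
apply: filterS => -[m n]/=; rewrite -(norm_orthonormal_sum _ _ _ oe).
by rewrite ger0_norm ?exprn_ge0// ltr_pXn2r ?nnegrE// ltW.
Qed.

(** The difference of the two sides is the squared norm of [x] minus its projection on the first [n]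
    vectors. *)
Lemma bessel e x n : orthonormal e ->
  \sum_(0 <= i < n) ip x (e i) ^+ 2 <= `|x| ^+ 2.
Proof.
move=> oe; rewrite -subr_ge0.
suff -> : `|x| ^+ 2 - \sum_(0 <= i < n) ip x (e i) ^+ 2 =
    `|x - \sum_(0 <= i < n) ip x (e i) *: e i| ^+ 2 by rewrite exprn_ge0.
set y := (X in x - X).
have xy : ip x y = \sum_(0 <= i < n) ip x (e i) ^+ 2.
  by rewrite ip_sumr; apply: eq_bigr => i _; rewrite ipZr expr2.
have yy : ip y y = \sum_(0 <= i < n) ip x (e i) ^+ 2.
  by rewrite ipxx norm_orthonormal_sum.
by rewrite -!ipxx ipBl !ipBr (ipC y x) yy xy; ring.
Qed.

Lemma ip_lim_series e (c : nat -> R) x j : orthonormal e ->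
  series (fun i => c i *: e i) @ \oo --> x -> ip x (e j) = c j.
Proof.
move=> oe /(cvg_ip (z := e j)) cx; apply/esym/(cvg_unique (@norm_hausdorff _ _) _ cx).
apply: cvg_near_cst; exists j.+1 => // n /= jn.
by rewrite ip_orthonormal_sum//= jn.
Qed.

(** This totality criterion is how every basis below is checked. For the converse direction, the
    Fourier series of [x] converges by Bessel's inequality, and its difference from [x] is
    orthogonal to every [e i]. *)
Lemma orthonormal_basisP (e : nat -> H) :
  orthonormal_basis ip setT e <->
  orthonormal e /\ forall x, (forall i, ip (e i) x = 0) -> x = 0.
Proof.
split=> [[_ oe de]|[oe te]].
  split=> // x ex; apply: ipxx_eq0.
  by apply: ip_span_closure ex _; exact: de.
split=> // x _.
have cv := orthonormal_series_cvg oe (fun n => bessel x n oe).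
suff -> : x = limn (series (fun i => ip x (e i) *: e i)).
  by apply: cvg_span_closure; exact: cv.
apply/eqP; rewrite -subr_eq0; apply/eqP; apply: te => i.
by rewrite ipC ipBl (ip_lim_series _ oe cv) subrr.
Qed.

(** The representer is the sum of the [l (e i) *: e i]. Testing [l] on the partial sums of this
    series shows that its coefficients are square summable. *)
Lemma riesz e (l : H -> R) (M : R) : orthonormal_basis ip setT e ->
  scalar l -> (forall x, `|l x| <= M * `|x|) -> exists r, forall x, l x = ip r x.
Proof.
move=> /orthonormal_basisP[oe te] ll lM.
have lD x y : l (x + y) = l x + l y by rewrite -[x]scale1r ll mul1r scale1r.
have l0 : l 0 = 0 by apply: (addrI (l 0)); rewrite -lD !addr0.
have lZ a x : l (a *: x) = a * l x by rewrite -[a *: x]addr0 ll l0 addr0.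
have lB x y : l (x - y) = l x - l y by rewrite lD -scaleN1r lZ mulN1r.
have ls c n : l (\sum_(0 <= i < n) c i *: e i) = \sum_(0 <= i < n) c i * l (e i).
  by rewrite (big_morph l lD l0); apply: eq_bigr => i _; rewrite lZ.
have bd n : \sum_(0 <= i < n) l (e i) ^+ 2 <= M ^+ 2.
  set S := (X in X <= _).
  pose y := \sum_(0 <= i < n) l (e i) *: e i.
  have S0 : 0 <= S by apply: sumr_ge0 => i _; exact: sqr_ge0.
  have yS : `|y| ^+ 2 = S by rewrite norm_orthonormal_sum.
  have lyS : l y = S by rewrite ls; apply: eq_bigr => i _; rewrite expr2.
  have := lM y; rewrite lyS ger0_norm// => SM.
  (* Here [l y] and the squared norm of [y] both equal [S], so the bound on [l y] squares to this
     one; dividing by [S] yields the claim. *)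
  have : S ^+ 2 <= M ^+ 2 * S by rewrite -yS -exprMn ler_pXn2r ?nnegrE// ?yS// (le_trans S0).
  have [->|Sn0] := eqVneq S 0; first by rewrite sqr_ge0.
  by rewrite expr2 ler_pM2r// lt_def Sn0.
have cv := orthonormal_series_cvg oe bd.
set r := limn _ in cv; exists r.
have rE i : ip r (e i) = l (e i) by exact: ip_lim_series oe cv.
move=> x; have cx := orthonormal_series_cvg oe (fun n => bessel x n oe).
have {}cx : series (fun i => ip x (e i) *: e i) @ \oo --> x.
  suff {2}-> : x = limn (series (fun i => ip x (e i) *: e i)) by exact: cx.
  apply/eqP; rewrite -subr_eq0; apply/eqP; apply: te => i.
  by rewrite ipC ipBl (ip_lim_series _ oe cx) subrr.
(* Both [l] and [ip r] are continuous and agree on the partial sums of the Fourier series of [x], so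
   they agree at [x]. *)
have h1 : ip (series (fun i => ip x (e i) *: e i) n) r @[n --> \oo] --> ip r x.
  by rewrite [ip r x]ipC; exact: cvg_ip.
rewrite -(cvg_lim _ h1)//; apply/esym/cvg_lim => //.
have -> : (fun n => ip (series (fun i => ip x (e i) *: e i) n) r) =
          (fun n => l (series (fun i => ip x (e i) *: e i) n)).
  apply/funext => n; rewrite /series/= ls ip_suml; apply: eq_bigr => i _.
  by rewrite ipZl (ipC (e i) r) rE.
apply/cvgrPdist_le => eps eps0.
have M1 : 0 < `|M| + 1 by rewrite ltr_wpDl.
move/cvgrPdist_le : cx => /(_ (eps / (`|M| + 1))); rewrite divr_gt0// => /(_ isT).
apply: filterS => n nE; rewrite -lB (le_trans (lM _))//.
rewrite ler_pdivlMr// in nE; rewrite (le_trans _ nE)// mulrC ler_wpM2l//.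
by rewrite (le_trans (ler_norm _))// lerDl.
Qed.

(* The basis is the image of [e] under the reflection exchanging [e 0] and the
   normalized Riesz representer of [l]. *)
Lemma basis_supporting_functional e (l : H -> R) (M : R) :
  orthonormal_basis ip setT e ->
  scalar l -> (forall x, `|l x| <= M * `|x|) ->
  exists s (e' : nat -> H), [/\ 0 <= s, orthonormal_basis ip setT e' &
    forall i, l (e' i) = s * (i == 0)%:R].
Proof.
move=> be ll lM; have [r lr] := riesz be ll lM.
have [r0|rn0] := eqVneq r 0.
  by exists 0, e; split=> // i; rewrite lr r0 ip0l mul0r.
have nr0 : `|r| != 0 by rewrite normr_eq0.
pose v := `|r|^-1 *: r.
have vv : ip v v = 1 by rewrite ipZl ipZr ipxx expr2 mulKf// mulVf.
have lv x : l x = `|r| * ip v x by rewrite ipZl mulVKf.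
have [oe te] := (orthonormal_basisP e).1 be.
(* If [e 0 = v] the given basis already works; otherwise [w] is nonzero and the reflection [U] along
   [w] is defined. *)
have [ev|env] := eqVneq (e 0) v.
  by exists `|r|, e; split=> // i; rewrite lv -ev oe eq_sym.
have [w wE] : exists w, w = e 0 - v by exists (e 0 - v).
have ww : ip w w != 0.
  by apply: contra_neq env => /ipxx_eq0 /eqP; rewrite wE subr_eq0 => /eqP.
pose U x := x - (2 * ip x w / ip w w) *: w.
have UU x y : ip (U x) (U y) = ip x y.
  by rewrite /U ipBl !ipBr !ipZl !ipZr (ipC w y); field.
have sU x y : ip (U x) y = ip x (U y).
  by rewrite /U ipBl ipBr ipZl ipZr (ipC w y); field.
have Ue0 : U (e 0) = v.
  (* Since [e 0] and [v] are unit vectors, [ip w w = 2 - 2 * ip (e 0) v = 2 * ip (e 0) w]. *)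
  rewrite /U (_ : 2 * _ / _ = 1) ?scale1r ?wE ?subKr//.
  rewrite -wE; apply: (mulIf ww); rewrite mul1r divfK//.
  by rewrite wE ipBl !ipBr vv oe eqxx (ipC v) mulr1n; ring.
exists `|r|, (U \o e); split => //; last first.
  by move=> i; rewrite lv -Ue0 UU oe eq_sym.
(* Totality survives because [U] is self-adjoint and isometric. *)
apply/orthonormal_basisP; split=> [i j|x Ux]; first by rewrite /= UU oe.
have Ux0 : U x = 0 by apply: te => i; rewrite -sU Ux.
by apply: ipxx_eq0; rewrite -UU Ux0 ip0l.
Qed.

(* The first [k] vectors form an orthonormal basis of the orthogonal complement
   of the common kernel of the [l i]: a maximal orthonormal family orthogonal
   to [f], which is finite since the matrix of the [l i] on it is row free. *)
Lemma complete_kernel_basis p (l : 'I_p -> H -> R) (f : nat -> H) :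
  (forall i, scalar (l i)) ->
  orthonormal_basis ip [set x | forall i, l i x = 0] f ->
  exists k (h : nat -> H), [/\ orthonormal_basis ip setT h,
    forall i, h (k + i)%N = f i &
    forall b : H -> R, exists c : 'I_p -> R, forall j, (j < k)%N ->
      b (h j) = \sum_i c i * l i (h j)].
Proof.
move=> ll [Vf of_ df].
have lD i x y : l i (x + y) = l i x + l i y by rewrite -[x]scale1r ll mul1r scale1r.
have l0 i : l i 0 = 0 by apply: (addrI (l i 0)); rewrite -lD !addr0.
have lZ i a x : l i (a *: x) = a * l i x by rewrite -[a *: x]addr0 ll l0 addr0.
pose Q k (g : nat -> H) :=
  (forall i j, (i < k)%N -> (j < k)%N -> ip (g i) (g j) = (i == j)%:R) /\
  (forall i j, (i < k)%N -> ip (g i) (f j) = 0).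
pose M k (g : nat -> H) : 'M[R]_(k, p) := \matrix_(j, i) l i (g j).
(* A vanishing combination of the rows yields a vector [x] in the common kernel, hence in the closed
   span of [f]; being also orthogonal to [f], it is 0, and so are its coefficients. *)
have Mfree k g : Q k g -> row_free (M k g).
  move=> [gg gf]; apply: inj_row_free => v vM.
  pose x := \sum_(j < k) v 0 j *: g j.
  have x0 : x = 0.
    apply: ipxx_eq0; apply: (@ip_span_closure f).
      move=> i; rewrite ipC ip_suml big1// => j _; rewrite ipZl gf ?mulr0//.
    apply: df => i; rewrite (big_morph (l i) (lD i) (l0 i)).
    have := congr1 (fun z : 'rV_p => z 0 i) vM; rewrite !mxE => hv; rewrite -[RHS]hv.
    by apply: eq_bigr => j _; rewrite lZ mxE.
  apply/rowP => j; rewrite mxE -[LHS]mulr1.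
  have : ip x (g j) = 0 by rewrite x0 ip0l.
  rewrite ip_suml (bigD1 j)//= ipZl gg// eqxx big1 ?addr0// => i ij.
  by rewrite ipZl gg// val_eqE (negbTE ij) mulr0.
pose q k := `[< exists g, Q k g >].
have exq : exists k, q k by exists 0%N; apply/asboolP; exists (fun _ => 0); split.
have qp k : q k -> (k <= p)%N.
  by move=> /asboolP[g /Mfree /eqP <-]; exact: rank_leq_col.
(* The matrix has [p] columns and rank [k], so [k] is bounded by [p] and a largest family exists. *)
have [k /asboolP[g Qg] kmax] := ex_maxnP exq qp.
have [gg gf] := Qg.
pose h i := if (i < k)%N then g i else f (i - k)%N.
have hk i : h (k + i)%N = f i by rewrite /h ltnNge leq_addr/= addKn.
have oh : orthonormal h.
  move=> i j; rewrite /h; case: ltnP => ik; case: ltnP => jk.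
  - exact: gg.
  - by rewrite gf// ltn_eqF// (leq_trans ik).
  - by rewrite ipC gf// gtn_eqF// (leq_trans jk).
  - by rewrite of_ -(eqn_add2r k) !subnK.
exists k, h; split=> //.
(* A nonzero vector orthogonal to all of [h] could be normalized and appended to [g], against the
   maximality of [k]. *)
- apply/orthonormal_basisP; split=> // x hx; apply/eqP; apply: contraT => x0.
  have nx0 : `|x| != 0 by rewrite normr_eq0.
  suff /kmax : q k.+1 by rewrite ltnn.
  apply/asboolP; exists (fun i => if (i < k)%N then g i else `|x|^-1 *: x).
  have gx i : (i < k)%N -> ip (g i) x = 0 by move=> ik; have := hx i; rewrite /h ik.
  split=> [i j|i j]; rewrite !ltnS.
    move=> ik jk; case: ltnP => ik'; case: ltnP => jk'.
    + exact: gg.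
    + by rewrite ipZr gx// mulr0 ltn_eqF// (leq_trans ik').
    + by rewrite ipZl ipC gx// mulr0 gtn_eqF// (leq_trans jk').
    + have -> : i = j by apply/eqP; rewrite eqn_leq (leq_trans ik jk') (leq_trans jk ik').
      by rewrite eqxx ipZl ipZr ipxx expr2 mulKf// mulVf.
  move=> ik; case: ltnP => ik'; first exact: gf.
  by rewrite ipZl ipC -hk hx mulr0.
(* A right inverse [B] of the row free matrix solves the linear system for the coefficients. *)
- move=> b; have /row_freeP[B MB] := Mfree _ _ Qg.
  pose y : 'cV_k := \col_j b (h j).
  exists (fun i => (B *m y) i 0) => j jk.
  have -> : b (h j) = (M k g *m (B *m y)) (Ordinal jk) 0.
    by rewrite mulmxA MB mul1mx mxE.
  by rewrite mxE; apply: eq_bigr => i _; rewrite mxE mulrC /= /h jk.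
Qed.

End inner_product_theory.

(** * Random series in the space of continuous functions *)

Section contFun_measurability.
Context {R : realType} {T : R}.
Implicit Types v : contFun T.

Lemma contFun_norm_le v t : `|v t| <= `|v|.
Proof. exact: le_supNorm. Qed.

(** Pointwise limits exist by completeness of the reals, the Cauchy bound passes to them uniformly
    in [t], and an [e / 3] argument makes the limit continuous. *)
Lemma contFun_cauchy_cvg (S : nat -> contFun T) :
  (forall e : R, 0 < e -> exists N, forall n, (N <= n)%N -> `|S n - S N| < e) ->
  cvgn S.
Proof.
move=> cS.
have cSt t : cvgn (fun n => S n t).
  apply: cauchy_cvg; apply/cauchyP => e e0.
  have [N SN] := cS e e0; exists (S N t); exists N => // n Nn.
  rewrite -ball_normE /= distrC (le_lt_trans _ (SN n Nn))//.
  exact: (contFun_norm_le (S n - S N)).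
pose L t := limn (fun n => S n t).
have SL (e : R) : 0 < e -> exists N, forall n, (N <= n)%N -> forall t, `|L t - S n t| <= e.
  move=> e0; have e2 : 0 < e / 2 by rewrite divr_gt0.
  have [N SN] := cS _ e2; exists N => n Nn t.
  have LN : `|L t - S N t| <= e / 2.
    have : `|S n t - S N t| @[n --> \oo] --> `|L t - S N t|.
      by apply: cvg_norm; apply: cvgB; [exact: cSt|exact: cvg_cst].
    move=> /cvgr_to_le; apply; exists N => // m /= Nm.
    by apply: le_trans (ltW (SN m Nm)); exact: (contFun_norm_le (S m - S N)).
  have nN : `|S N t - S n t| <= e / 2.
    rewrite distrC; apply: le_trans (ltW (SN n Nn)).
    exact: (contFun_norm_le (S n - S N)).
  by rewrite (splitr e) (le_trans (ler_distD (S N t) _ _))// lerD.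
have cL : continuous L.
  move=> t; apply/(@cvgrPdist_le _ _ _ (nbhs t)) => e e0.
  have e3 : 0 < e / 3 by rewrite divr_gt0.
  have [N /(_ N (leqnn N)) SN] := SL _ e3.
  have : {for t, continuous (S N)} by exact: cts_fun.
  move=> /cvgrPdist_le/(_ (e / 3)); rewrite divr_gt0// => /(_ isT).
  apply: filterS => y ty.
  rewrite (_ : L t - L y = (L t - S N t) + (S N t - S N y) + (S N y - L y)); last by ring.
  rewrite (_ : e = e / 3 + e / 3 + e / 3); last by field.
  rewrite (le_trans (ler_normD _ _))// lerD// ?(distrC (S N y))//.
  by rewrite (le_trans (ler_normD _ _))// lerD.
apply/cvg_ex; exists (mkContFun cL : contFun T); apply/cvgrPdist_le => e e0.
have [N SN] := SL e e0; exists N => // n /= Nn.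
by apply: supNorm_le => [|t]; [exact: ltW|exact: SN].
Qed.

Lemma continuous_contFun_measurable (a : contFun T -> R) :
  continuous a -> measurable_fun setT a.
Proof.
move=> ca; apply: (measurability _ (RGenOpens.measurableE R)) => _ [_ [x [y ->]] <-].
rewrite setTI; apply: sub_sigma_algebra.
by move: ca => /continuousP ca; apply: ca; exact: interval_open.
Qed.

Lemma measurable_contFunP d (W : measurableType d) (F : W -> contFun T) :
  (forall U, open U -> measurable (F @^-1` U)) -> measurable_fun setT F.
Proof.
move=> FO; apply: (@measurability _ _ _ _ _ _ (@open (contFun T))) => //.
by move=> _ [U oU <-]; rewrite setTI; exact: FO.
Qed.

Lemma open_contFun_measurable (U : set (contFun T)) : open U -> measurable U.
Proof. exact: sub_sigma_algebra. Qed.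

(** * Measurability of random sums and their limits *)

Section limits.
Context {d : measure_display} {W : measurableType d}.

(** The preimage of an open set is written as a countable union: a rational [q] approximates [x w]
    to within [1 / (m + 1)], and [F w] lies in the open set [K q m], whose points stay in [U] after
    adding [r *: v] for any [r] that close to [q]. *)
Lemma measurable_contFunDZ (F : W -> contFun T) (x : W -> R) v :
  measurable_fun setT F -> measurable_fun setT x ->
  measurable_fun setT (fun w => F w + x w *: v).
Proof.
move=> mF mx; apply: measurable_contFunP => U oU.
pose K (q : rat) (m : nat) : set (contFun T) :=
  interior [set y | forall r : R, `|r - ratr q| < m.+1%:R^-1 -> U (y + r *: v)].
have -> : (fun w => F w + x w *: v) @^-1` U = \bigcup_(q in [set: rat])
    \bigcup_m ((x @^-1` ball (ratr q : R) m.+1%:R^-1) `&` (F @^-1` K q m)).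
  apply/seteqP; split => w /=; last first.
    move=> [q _ [m _ [xq /interior_subset]]]; apply.
    by move: xq; rewrite /= -ball_normE/= distrC.
  move: (oU); rewrite openE => /[apply] /nbhs_ballP[e /= e0 eU].
  (* The numbers [x w] and [r] are both within [1 / (m + 1)] of [q], so with this factor 4 replacing
     one by the other moves the sum by at most [e / 2]; the other half is left for [y]. *)
  have v1 : 0 < 4 * (`|v| + 1) by rewrite mulr_gt0// ltr_wpDl.
  have [m _ /(_ m (leqnn m))/= mlt] :=
    near_infty_natSinv_lt (PosNum (divr_gt0 e0 v1)).
  have m0 : (0 : R) < m.+1%:R^-1 by rewrite invr_gt0.
  have [|q] := @rat_in_itvoo R (x w - m.+1%:R^-1) (x w).
    by rewrite ltrBlDr ltrDl.
  rewrite in_itv/= => /andP[q1 q2].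
  have xq : `|x w - ratr q| < m.+1%:R^-1.
    by rewrite ger0_norm ?subr_ge0 ?ltW// ltrBlDr -ltrBlDl.
  exists q => //; exists m => //; split; first by rewrite /= -ball_normE/= distrC.
  apply/nbhs_ballP; exists (e / 2); first by rewrite /= divr_gt0.
  move=> y /=; rewrite -ball_normE/= => Fy r rq; apply: eU; rewrite -ball_normE/=.
  rewrite opprD addrACA -scalerBl (splitr e) (le_lt_trans (ler_normD _ _))//.
  rewrite ltr_leD// normrZ.
  have : `|x w - r| <= 2 * m.+1%:R^-1.
    rewrite (_ : x w - r = (x w - ratr q) + (ratr q - r)); last by ring.
    rewrite mulrDl mul1r (le_trans (ler_normD _ _))// lerD// ?ltW//.
    by rewrite distrC.
  move=> xr; rewrite (@le_trans _ _ (2 * m.+1%:R^-1 * (`|v| + 1)))//.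
    by rewrite ler_pM// lerDl.
  move: mlt; rewrite /= ltr_pdivlMr// => /ltW.
  by move: m.+1%:R^-1 (`|v| + 1) => a b; lra.
apply: bigcupT_measurable_rat => q; apply: bigcupT_measurable => m.
apply: measurableI; rewrite -[X in measurable X]setTI.
  by apply: mx => //; apply: open_measurable; exact: ball_open.
by apply: mF => //; apply: open_contFun_measurable; exact: open_interior.
Qed.

Lemma measurable_contFun_sum (x : nat -> W -> R) (v : nat -> contFun T) r :
  (forall i, measurable_fun setT (x i)) ->
  measurable_fun setT (fun w => \sum_(i <- r) x i w *: v i).
Proof.
move=> mx; elim: r => [|i r IH].
  by under eq_fun do rewrite big_nil; exact: measurable_cst.
by under eq_fun do rewrite big_cons addrC; exact: measurable_contFunDZ.
Qed.

(** The limit lies in [U] exactly when, for some [m], the balls of radius [1 / (m + 1)] around all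
    late enough [F n w] are contained in [U]. The sets [K m] of such centres are closed. *)
Lemma measurable_contFun_lim (F : nat -> W -> contFun T) (G : W -> contFun T) :
  (forall n, measurable_fun setT (F n)) ->
  (forall w, F n w @[n --> \oo] --> G w) -> measurable_fun setT G.
Proof.
move=> mF FG; apply: measurable_contFunP => U oU.
pose K (m : nat) : set (contFun T) := [set y | ball y m.+1%:R^-1 `<=` U].
have Kclosed m : measurable (K m).
  rewrite -[K m]setCK; apply: measurableC; apply: open_contFun_measurable.
  rewrite openE => y /existsNP[z /not_implyP[yz nUz]].
  rewrite -ball_normE/= in yz.
  apply/nbhs_ballP; exists (m.+1%:R^-1 - `|y - z|); first by rewrite /= subr_gt0.
  move=> y'; rewrite -ball_normE/= => yy' /(_ z) Kz; apply: nUz; apply: Kz.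
  rewrite -ball_normE/= (le_lt_trans (ler_distD y _ _))//.
  by rewrite distrC -ltrBrDr.
have -> : G @^-1` U = \bigcup_m \bigcup_N \bigcap_n (F (N + n)%N @^-1` K m).
  apply/seteqP; split => w /=.
    move: (oU); rewrite openE => /[apply] /nbhs_ballP[e /= e0 eU].
    (* The radius is below [e / 2]: it is spent once between [G w] and [F (N + n) w] and once
       between the latter and [z]. *)
    have [m _ /(_ m (leqnn m))/= mlt] :=
      near_infty_natSinv_lt (PosNum (divr_gt0 e0 (ltr0Sn _ 1))).
    have m0 : (0 : R) < m.+1%:R^-1 by rewrite invr_gt0.
    move/cvgrPdist_lt : (FG w) => /(_ _ m0)[N _ NF].
    exists m => //; exists N => // n _ /= z; rewrite -ball_normE/= => Fz.
    apply: eU; rewrite -ball_normE/= (le_lt_trans (ler_distD (F (N + n)%N w) _ _))//.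
    have := NF (N + n)%N (leq_addr _ _); move: mlt Fz => /=.
    by move: m.+1%:R^-1 => a; lra.
  move=> [m _ [N _ NF]].
  have m0 : (0 : R) < m.+1%:R^-1 by rewrite invr_gt0.
  move/cvgrPdist_lt : (FG w) => /(_ _ m0)[N' _ N'F].
  apply: (NF N' I); rewrite -ball_normE/= distrC; apply: N'F.
  by rewrite /= leq_addl.
apply: bigcupT_measurable => m; apply: bigcupT_measurable => N.
apply: bigcapT_measurable => n; rewrite -[X in measurable X]setTI.
exact: mF.
Qed.

Variables (x : nat -> W -> R) (v : nat -> contFun T).
Hypothesis mx : forall i, measurable_fun setT (x i).

(** Convergence is the Cauchy criterion, which only takes countable unions and intersections over
    tolerances [1 / (m + 1)] and blocks of [n] terms starting at [N]. *)
Lemma measurable_cvg_series :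
  measurable [set w | cvgn (series (fun i => x i w *: v i))].
Proof.
have -> : [set w | cvgn (series (fun i => x i w *: v i))] =
  \bigcap_m \bigcup_N \bigcap_n
    [set w | ball 0 m.+1%:R^-1 (\sum_(N <= i < N + n) x i w *: v i)].
  apply/seteqP; split => w /=.
    move=> /cvg_cauchy/cauchy_seriesP cw m _.
    have m0 : (0 : R) < m.+1%:R^-1 by rewrite invr_gt0.
    have [[A B] [[N _ NA] [N' _ NB]] ABw] := cw _ m0.
    exists (maxn N N') => // n _ /=; rewrite -ball_normE/= sub0r normrN.
    apply: (ABw (_, _)); split; [apply: NA|apply: NB] => /=; first exact: leq_maxl.
    by rewrite (leq_trans (leq_maxr N N'))// leq_addr.
  move=> cw; apply: contFun_cauchy_cvg => e e0.
  have [m _ /(_ m (leqnn m))/= mlt] := near_infty_natSinv_lt (PosNum e0).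
  have [N _ Nw] := cw m I; exists N => n Nn.
  have := Nw (n - N)%N I; rewrite -ball_normE/= sub0r normrN subnKC// => /lt_trans.
  by rewrite sub_series_geq//; apply.
apply: bigcapT_measurable => m; apply: bigcupT_measurable => N.
apply: bigcapT_measurable => n; rewrite -[X in measurable X]setTI.
apply: (@measurable_contFun_sum x v (index_iota N (N + n)) mx measurableT).
by apply: open_contFun_measurable; exact: ball_open.
Qed.

(** The default value 0 off the convergence set makes the sum a total function of the coefficient
    sequence, so that equality in law of two sequences passes to their sums. *)
Definition series_lim (c : nat -> R) : contFun T :=
  if `[< cvgn (series (fun i => c i *: v i)) >]
  then limn (series (fun i => c i *: v i)) else 0.

Lemma measurable_series_lim : measurable_fun setT (fun w => series_lim (x^~ w)).
Proof.
pose p w := `[< cvgn (series (fun i => x i w *: v i)) >].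
have mp : measurable_fun setT p.
  apply: (measurable_fun_bool true); rewrite setTI.
  rewrite (_ : _ @^-1` _ = [set w | cvgn (series (fun i => x i w *: v i))]).
    exact: measurable_cvg_series.
  by apply/seteqP; split => w /=; rewrite /p => /asboolP.
(* Partial sums replaced by 0 on the divergence set converge everywhere. *)
apply: (@measurable_contFun_lim
  (fun n w => if p w then series (fun i => x i w *: v i) n else 0)) => [n|w].
  by apply: measurable_fun_ifT => //; exact: measurable_contFun_sum.
rewrite /series_lim -/(p w); case: ifPn => [/asboolP//|_]; exact: cvg_cst.
Qed.

End limits.
End contFun_measurability.

(** * Laws of independent sequences *)

Section sequence_law.
Context {R : realType}.

Definition cylinder : set (set (nat -> R)) :=
  [set C | exists (n : nat) (B : nat -> set R), (forall i, measurable (B i)) /\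
    C = [set x | forall i, (i < n)%N -> B i (x i)]].

(** The space of real sequences with its product sigma-algebra. *)
Definition seqSpace := g_sigma_algebraType cylinder.

Lemma measurable_coord i : measurable_fun setT (fun x : seqSpace => x i).
Proof.
move=> _ B mB; rewrite setTI; apply: sub_sigma_algebra.
exists i.+1, (fun j => if j == i then B else setT); split.
  by move=> j; case: ifP.
apply/seteqP; split => x /=.
  by move=> Bx j _; case: eqP => // ->.
by move=> /(_ i (ltnSn i)); rewrite eqxx.
Qed.

Lemma measurable_seq d (W : measurableType d) (x : nat -> W -> R) :
  (forall i, measurable_fun setT (x i)) ->
  @measurable_fun _ _ W seqSpace setT (fun w => x^~ w).
Proof.
move=> mx; apply: (@measurability _ _ W seqSpace setT _ cylinder erefl).
move=> _ [_ [n [B [mB ->]] <-]]; rewrite setTI.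
rewrite (_ : _ @^-1` _ = \bigcap_(i in `I_n) (x i @^-1` B i)); last first.
  by apply/seteqP; split => w.
apply: bigcap_measurableType => i _; rewrite -[X in measurable X]setTI.
exact: mx.
Qed.

Lemma cylinder_setI : setI_closed cylinder.
Proof.
move=> _ _ [n [B [mB ->]]] [m [C [mC ->]]].
exists (maxn n m), (fun i => (if (i < n)%N then B i else setT) `&`
                             (if (i < m)%N then C i else setT)); split.
  by move=> i; apply: measurableI; case: ifP.
apply/seteqP; split => x /=.
  by move=> [xB xC] i _; split; case: ifPn => //; [exact: xB|exact: xC].
move=> xBC; split=> i ilt.
  by have [] := xBC i (leq_trans ilt (leq_maxl _ _)); rewrite ilt.
by have [_] := xBC i (leq_trans ilt (leq_maxr _ _)); rewrite ilt.
Qed.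

Context {d : measure_display} {W : measurableType d} (P : probability W R).

(** Independence and equal marginals make the two laws agree on cylinders, a generating family
    stable under intersection, so they agree everywhere. *)
Lemma independent_rvs_law (x y : nat -> {mfun W >-> R}) :
  independent_rvs P x -> independent_rvs P y ->
  (forall i B, measurable B -> P (x i @^-1` B) = P (y i @^-1` B)) ->
  forall E : set seqSpace, measurable E ->
  P [set w | E (x^~ w)] = P [set w | E (y^~ w)].
Proof.
move=> ix iy xy E mE.
have mX : @measurable_fun _ _ W seqSpace setT (fun w => x^~ w) by exact: measurable_seq.
have mY : @measurable_fun _ _ W seqSpace setT (fun w => y^~ w) by exact: measurable_seq.
pose X : {mfun W >-> seqSpace} := mfun_Sub (mem_set mX).
pose Y : {mfun W >-> seqSpace} := mfun_Sub (mem_set mY).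
apply: (@g_sigma_algebra_measure_unique _ R seqSpace cylinder _ (fun=> setT) _ _
  (distribution P X) (distribution P Y)) => //.
- exact: sub_sigma_algebra.
- move=> _; exists 0%N, (fun=> setT); split => //.
  by apply/seteqP; split.
- by rewrite bigcup_const//; exists 0%N.
- exact: cylinder_setI.
- move=> _ [n [B [mB ->]]]; rewrite /distribution /pushforward.
  pose J := [fset i in iota 0 n]%fset.
  have JE (z : nat -> W -> R) : (fun w => (z^~ w : seqSpace)) @^-1`
      [set x | forall i, (i < n)%N -> B i (x i)] = \bigcap_(i in [set` J]) z i @^-1` B i.
    apply/seteqP; split => w /= zB i.
      by rewrite /J/= !inE/= mem_iota add0n => /= /zB.
    by move=> ilt; apply: zB; rewrite /J/= !inE mem_iota.
  rewrite [LHS](congr1 P (JE x)) [RHS](congr1 P (JE y)) ix// iy//.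
  by apply: eq_bigr => i _; exact: xy.
- by move=> k; apply: le_lt_trans (probability_le1 _ measurableT) (ltry 1).
Qed.

(** Independence of [x] is applied to the translated index set [k + J], with the events reindexed
    accordingly. *)
Lemma independent_rvs_shift (x : nat -> W -> R) k :
  independent_rvs P x -> independent_rvs P (fun i => x (k + i)%N).
Proof.
move=> ix J B mB.
have := ix [fset (k + i)%N | i in J]%fset (fun j => B (j - k)%N) (fun=> mB _).
rewrite big_imfset/=; last by move=> i j _ _; exact: addnI.
under eq_bigr do rewrite addKn.
move=> <-; congr (P _); apply/seteqP; split => w /= xB i.
  by move=> /imfsetP[j /= jJ ->]; rewrite addKn; exact: xB.
move=> iJ; have := xB (k + i)%N; rewrite addKn; apply.
by apply/imfsetP; exists i.
Qed.

End sequence_law.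

(** * The normal distribution *)

Section normal_scaling.
Context {R : realType}.
Local Notation mu := (@lebesgue_measure R).

(** The right-hand side is a measure in [A] that gives half-open intervals their length, so
    uniqueness of Lebesgue measure applies. *)
Lemma lebesgue_measure_scale (s : R) (s0 : 0 < s) (A : set R) : measurable A ->
  mu A = (s%:E * mu ((fun x => s * x)%R @^-1` A))%E.
Proof.
move=> mA.
have ms : @measurable_fun _ _ (measurableTypeR R) (measurableTypeR R) setT
    (fun x => s * x).
  exact: measurable_funM.
pose f : measurableTypeR R -> measurableTypeR R := fun x => s * x.
pose nu' := mscale (NngNum (ltW s0)) (pushforward mu f).
pose nu : {measure set (measurableTypeR R) -> \bar R} := nu' ms.
rewrite -[RHS]/(nu A).
apply: lebesgue_measure_unique => // _ [[a b]] _ <-.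
rewrite -[RHS]/(s%:E * mu (f @^-1` `]a, b]))%E.
rewrite [X in (_ * _ X)%E](_ : _ = `]a / s, b / s]%classic); last first.
  apply/seteqP; split => x /=;
    by rewrite /f !in_itv/= ltr_pdivrMr// ler_pdivlMr// (mulrC s).
rewrite !lebesgue_measure_itv/= !lte_fin ltr_pM2r ?invr_gt0//.
case: ifP => _; last by rewrite mule0.
by rewrite -!EFinD -EFinM; congr EFin; field; rewrite gt_eqF.
Qed.

(** Substitution [y = s * x]: the factor [s] from Lebesgue measure cancels the [s] in the peak of
    the density. *)
Lemma normal_prob_scale (s : R) (s0 : 0 < s) (B : set R) : measurable B ->
  normal_prob 0 1 ((fun x => s * x)%R @^-1` B) = normal_prob 0 s B.
Proof.
move=> mB; rewrite /normal_prob.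
have expE (x : R) : - x ^+ 2 / (1 *+ 2) = - (s * x) ^+ 2 / (s ^+ 2 *+ 2).
  by field; rewrite gt_eqF.
have ms : @measurable_fun _ _ (measurableTypeR R) (measurableTypeR R) setT
    (fun x => s * x).
  exact: measurable_funM.
pose f : measurableTypeR R -> measurableTypeR R := fun x => s * x.
pose nu' := mscale (NngNum (ltW s0)) (pushforward mu f).
pose nu : {measure set (measurableTypeR R) -> \bar R} := nu' ms.
rewrite [RHS](@eq_measure_integral _ _ _ _ nu); last first.
  by move=> A mA _; exact: lebesgue_measure_scale.
have mpdf : measurable_fun B (fun x => (normal_pdf 0 s x)%:E).
  by apply/measurable_EFinP/measurable_funTS; exact: measurable_normal_pdf.
rewrite ge0_integral_mscale//; last first.
  by move=> x _; rewrite lee_fin normal_pdf_ge0.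
rewrite [X in (_ * X)%E](ge0_integral_pushforward ms)//; last first.
  by move=> y _; rewrite lee_fin normal_pdf_ge0.
rewrite -ge0_integralZl//=.
- apply: eq_integral => x _; rewrite -EFinM; congr EFin.
  rewrite /normal_pdf oner_eq0 gt_eqF//= /normal_peak /normal_fun !subr0 !expr1n.
  rewrite -[s ^+ 2 * pi *+ 2]mulrnAr sqrtrM ?sqr_ge0// sqrtr_sqr gtr0_norm//.
  rewrite mul1r invfM !mulrA mulfV ?gt_eqF// mul1r; congr (_ * expR _).
  exact: expE.
- by rewrite -[X in measurable X]setTI; apply: (ms measurableT).
- apply/measurable_EFinP/measurable_funTS/measurableT_comp => //.
  exact: measurable_normal_pdf.
- by move=> x _; rewrite lee_fin normal_pdf_ge0.
- by rewrite lee_fin ltW.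
Qed.

(** The factor 2 equalizes the peaks, and the quotient [expR (3 / 8 * x ^+ 2)] of the exponentials
    dominates the absolute value of [x]. *)
Lemma normal_pdf_mul_le (x : R) :
  `|x| * normal_pdf 0 1 x <= 2 * normal_pdf 0 2 x.
Proof.
have p2 : (2 : R) != 0 by [].
rewrite !normal_pdfE ?oner_eq0//= /normal_peak /normal_fun !subr0 !expr1n mul1r.
rewrite -[2 ^+ 2 * pi *+ 2]mulrnAr sqrtrM ?sqr_ge0// sqrtr_sqr (@gtr0_norm _ 2)//.
rewrite invfM !mulrA mulfV// mul1r (mulrC `|x|) -mulrA ler_wpM2l ?invr_ge0//.
have -> : - x ^+ 2 / (2 ^+ 2 *+ 2) = 3 / 8 * x ^+ 2 + - x ^+ 2 / (1 *+ 2) :> R.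
  by field.
rewrite expRD ler_wpM2r ?expR_ge0//.
apply: le_trans (expR_ge1Dx _); rewrite -(real_normK (num_real x)).
(* The point [4 / 3] minimizes [1 + 3 / 8 * y ^+ 2 - y]. *)
have := sqr_ge0 (`|x| - 4 / 3).
by move: `|x| => y; rewrite sqrrB; lra.
Qed.

(** The first absolute moment is turned into a Lebesgue integral by the Radon-Nikodym derivative,
    which equals the density almost everywhere, and is bounded by twice the total mass of another
    normal density. *)
Lemma integrable_normal_id :
  (normal_prob (0 : R) 1).-integrable setT (EFin \o (fun x : R => x)).
Proof.
apply/integrableP; split; first exact/measurable_EFinP.
have nmu := @normal_prob_dominates R 0 1.
have mabs : measurable_fun setT (fun x : measurableTypeR R => `|x%:E|%E).
  by apply: measurableT_comp => //; exact/measurable_EFinP.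
have mpdf s : measurable_fun setT
    (fun x : measurableTypeR R => (normal_pdf 0 s x)%:E).
  by apply/measurable_EFinP; exact: measurable_normal_pdf.
rewrite -(Radon_Nikodym_SigmaFinite.change_of_variables nmu)//=.
rewrite (ae_eq_integral
  (fun x : measurableTypeR R => `|x%:E| * (normal_pdf 0 1 x)%:E)%E)//; first last.
- apply: ae_eqe_mul2l; apply: integral_ae_eq => //.
  + exact: Radon_Nikodym_SigmaFinite.f_integrable.
  + by move=> E _ mE; rewrite -Radon_Nikodym_SigmaFinite.f_integral.
- by apply: emeasurable_funM => //; exact: mpdf.
- apply: emeasurable_funM => //; apply: measurable_int.
  exact: Radon_Nikodym_SigmaFinite.f_integrable.
apply: (@le_lt_trans _ _ (\int[mu]_x (2%:E * (normal_pdf 0 2 x)%:E))%E).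
  apply: ge0_le_integral => //.
  - by move=> x _; rewrite mule_ge0// lee_fin normal_pdf_ge0.
  - by apply: emeasurable_funM => //; exact: mpdf.
  - by apply: emeasurable_funM => //; exact: mpdf.
  - by move=> x _; rewrite abse_EFin -!EFinM lee_fin normal_pdf_mul_le.
rewrite ge0_integralZl//; last by move=> x _; rewrite lee_fin normal_pdf_ge0.
by rewrite integral_normal_pdf mule1 ltry.
Qed.

End normal_scaling.

(** * Laws and continuous linear functionals *)

Section laws.
Context {R : realType}.

Lemma ae_eq_probability d (W : measurableType d) (P : probability W R)
    (E F : set W) : measurable E -> measurable F ->
  {ae P, forall w, E w <-> F w} -> P E = P F.
Proof.
move=> mE mF EF.
rewrite -[E]setIT -[F]setIT -!integral_indic//; apply: ae_eq_integral => //.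
- exact/measurable_EFinP/measurable_indic.
- exact/measurable_EFinP/measurable_indic.
apply: filterS EF => w EF _; rewrite !indicE.
by rewrite (_ : (w \in E) = (w \in F))//; apply/idP/idP; rewrite !inE => /EF.
Qed.

Context {d d' e : measure_display} {W : measurableType d}
  {W' : measurableType d'} {S : measurableType e}.
Variables (P : probability W R) (P' : probability W' R).
Variables (X : {mfun W >-> S}) (Y : {mfun W' >-> S}).
Hypothesis XY : forall F, measurable F -> distribution P X F = distribution P' Y F.

Lemma same_law_integrable (f : S -> R) : measurable_fun setT f ->
  P'.-integrable setT (EFin \o (f \o Y)) -> P.-integrable setT (EFin \o (f \o X)).
Proof.
move=> mf /integrableP[_ fY]; apply/integrableP; split.
  by apply/measurable_EFinP; exact: measurableT_comp.
have mabs : measurable_fun setT (fun x => `|(f x)%:E|%E).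
  by apply: measurableT_comp => //; exact/measurable_EFinP.
move: fY.
rewrite -[X in (X < _)%E -> _](@ge0_integral_distribution _ _ _ _ _ P' Y
  (fun x => `|(f x)%:E|%E))//.
rewrite -[X in _ -> (X < _)%E](@ge0_integral_distribution _ _ _ _ _ P X
  (fun x => `|(f x)%:E|%E))//.
rewrite [X in _ -> (X < _)%E](eq_measure_integral (distribution P' Y))//.
by move=> F mF _; exact: XY.
Qed.

Lemma same_law_integral (f : S -> R) (F : set S) : measurable_fun setT f ->
  P'.-integrable setT (EFin \o (f \o Y)) -> measurable F ->
  (\int[P]_(w in X @^-1` F) (f (X w))%:E = \int[P']_(w in Y @^-1` F) (f (Y w))%:E)%E.
Proof.
move=> mf fY mF.
have mfE : measurable_fun setT (EFin \o f) by exact/measurable_EFinP.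
have mXF : measurable (X @^-1` F) by rewrite -[X in measurable X]setTI; exact: measurable_funP.
have mYF : measurable (Y @^-1` F) by rewrite -[X in measurable X]setTI; exact: measurable_funP.
have fX := same_law_integrable mf fY.
rewrite -[LHS](@integral_pushforward _ _ _ _ _ X _ P F (EFin \o f))//; last first.
  exact: integrableS fX.
rewrite -[RHS](@integral_pushforward _ _ _ _ _ Y _ P' F (EFin \o f))//; last first.
  exact: integrableS fY.
by apply: eq_measure_integral => G mG _; exact: XY.
Qed.

End laws.

Section dual.
Context {R : realType} {T : R}.
Implicit Types a b : contFun T -> R.

Section dual_linear.
Variable b : contFun T -> R.
Hypothesis db : dualSpace _ b.

Lemma dualD x y : b (x + y) = b x + b y.
Proof. by case: db => lb _; rewrite -[x]scale1r lb mul1r scale1r. Qed.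

Lemma dual0 : b 0 = 0.
Proof. by apply: (addrI (b 0)); rewrite -dualD !addr0. Qed.

Lemma dualZ c x : b (c *: x) = c * b x.
Proof. by case: db => lb _; rewrite -[c *: x]addr0 lb dual0 addr0. Qed.

Lemma dualN x : b (- x) = - b x.
Proof. by rewrite -scaleN1r dualZ mulN1r. Qed.

Lemma dual_series (x : nat -> R) (v : nat -> contFun T) L :
  series (fun i => x i *: v i) @ \oo --> L ->
  series (fun i => x i * b (v i)) @ \oo --> b L.
Proof.
move=> xL.
rewrite (_ : series (fun i => x i * b (v i)) =
             b \o series (fun i => x i *: v i)); last first.
  apply/funext => n; rewrite /series/= (big_morph b dualD dual0).
  by under [RHS]eq_bigr do rewrite dualZ.
by apply: cvg_comp xL _; case: db => _; apply.
Qed.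

Lemma measurable_dual : measurable_fun setT b.
Proof. by apply: continuous_contFun_measurable; case: db. Qed.

Lemma dual_bounded : exists M, forall x, `|b x| <= M * `|x|.
Proof.
case: db => lb cb.
pose bL := @GRing.isLinear.Build R (contFun T) R *%R b lb.
pose B : {linear contFun T -> R^o} := HB.pack b bL.
have /linear_boundedP : bounded_near B (nbhs 0).
  by apply/linear_bounded_continuous; exact: cb.
move=> /pinfty_ex_gt0[M _ BM]; exists M; exact: BM.
Qed.

End dual_linear.

Lemma dualB a b : dualSpace _ a -> dualSpace _ b ->
  dualSpace (contFun T) (fun x => a x - b x).
Proof.
move=> [la ca] [lb cb]; split=> [c x y|x]; first by rewrite la lb; ring.
by apply: continuousB; [exact: ca|exact: cb].
Qed.

Lemma dual_sum p (a : 'I_p -> contFun T -> R) (c : 'I_p -> R) :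
  (forall i, dualSpace _ (a i)) ->
  dualSpace (contFun T) (fun x => \sum_i c i * a i x).
Proof.
move=> da; split=> [r x y|].
  rewrite mulr_sumr -big_split/=; apply: eq_bigr => i _.
  by case: (da i) => -> _; ring.
have cai i : continuous (fun x : contFun T => c i * a i x).
  case: (da i) => _ cai x.
  by apply: (@continuousM R (contFun T)); [exact: cst_continuous|exact: cai].
elim: (index_enum _) => [|i r IH].
  by under eq_fun do rewrite big_nil; exact: cst_continuous.
rewrite (_ : (fun x => _) = (fun x => c i * a i x + \sum_(j <- r) c j * a j x)).
  by move=> x; apply: (@continuousD R R (contFun T)); [exact: cai|exact: IH].
by apply/funext => x; rewrite big_cons.
Qed.

Lemma dual_eval (t : timeInterval T) : dualSpace (contFun T) (fun x => x t).
Proof.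
split=> // x; apply/(@cvgrPdist_lt _ _ _ (nbhs x)) => e e0.
have := @nbhsx_ballx _ _ x _ e0; apply: filterS => y; rewrite -ball_normE/=.
exact/le_lt_trans/(contFun_norm_le (x - y)).
Qed.

End dual.

(** * Gaussian functionals *)

Section series_of_functionals.
Context {R : realType} {T : R} {d : measure_display} {W : measurableType d}.
Variable P : probability W R.

Lemma as_sum_functional (om : nat -> W -> R) (v : nat -> contFun T)
    (Y : W -> contFun T) (b : contFun T -> R) : dualSpace _ b ->
  as_sum P om v Y ->
  {ae P, forall w, series (fun i => om i w * b (v i)) @ \oo --> b (Y w)}.
Proof. by move=> db; apply: filterS => w; exact: dual_series. Qed.

(** Both scalar series converge almost surely, so by uniqueness of limits comparing their terms
    gives an almost sure identity between functionals of [Y] and [Y']. *)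
Lemma as_sum_functional_eq (om om' : nat -> W -> R) (v v' : nat -> contFun T)
    (Y Y' : W -> contFun T) (b b' : contFun T -> R) :
  dualSpace _ b -> dualSpace _ b' -> as_sum P om v Y -> as_sum P om' v' Y' ->
  (forall w L, series (fun i => om i w * b (v i)) @ \oo --> (L : R) ->
               series (fun i => om' i w * b' (v' i)) @ \oo --> L) ->
  {ae P, forall w, b (Y w) = b' (Y' w)}.
Proof.
move=> db db' /(as_sum_functional db) sY /(as_sum_functional db') sY' vv'.
apply: filterS2 sY sY' => w /vv' h1 h2.
by rewrite -(cvg_lim _ h1)// -(cvg_lim _ h2).
Qed.

Lemma series_add (V : zmodType) (x : nat -> V) k n :
  series x (n + k)%N = series x k + series (fun i => x (k + i)%N) n.
Proof.
rewrite /series/= (big_cat_nat (leq0n k) (leq_addl n k))/=; congr (_ + _).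
rewrite -{1}[k]add0n big_addn addnK; apply: eq_bigr => i _.
by rewrite addnC.
Qed.

End series_of_functionals.

Section gaussian_functionals.
Context {R : realType} {T : R}.
Context {d : measure_display} {Omega : measurableType d} (P : probability Omega R).
Variable X : {mfun Omega >-> contFun T}.
Context {H : completeNormedModType R} {ip : H -> H -> R}.
Hypothesis H_ip : inner_product ip.
Variable u : {linear H -> contFun T}.
Hypothesis u_bdd : bounded_operator u.
Context {d' : measure_display} {Omega' : measurableType d'}
  (P' : probability Omega' R).
Variable om : nat -> {mfun Omega' >-> R}.
Hypothesis om_iid : iid_standard_normal P' om.
Hypothesis X_series : forall h : nat -> H, orthonormal_basis ip setT h ->
    exists Y : {mfun Omega' >-> contFun T},
      as_sum P' om (u \o h) Y /\
      forall F : set (contFun T), measurable F ->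
        distribution P' Y F = distribution P X F.
Variable e : nat -> H.
Hypothesis e_basis : orthonormal_basis ip setT e.

(* In a basis whose first vector carries the whole functional [b \o u], the
   series of [b X] reduces to its first term. *)
Lemma functional_series b : dualSpace (contFun T) b ->
  exists (s : R) (Y : {mfun Omega' >-> contFun T}), [/\ 0 <= s,
    forall F : set (contFun T), measurable F ->
      distribution P X F = distribution P' Y F &
    {ae P', forall w, b (Y w) = s * om 0 w}].
Proof.
move=> db; have [lb cb] := db.
have [K uK] := u_bdd; have [M bM] := dual_bounded db.
have l_lin : scalar (b \o u) by move=> c x y; rewrite /= linearP lb.
have l_bdd x : `|(b \o u) x| <= (`|M| * K) * `|x|.
  apply: le_trans (bM _) _; rewrite -mulrA.
  apply: (@le_trans _ _ (`|M| * `|u x|)); first by rewrite ler_wpM2r// ler_norm.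
  by rewrite ler_wpM2l.
have [s [h [s0 hb lh]]] := basis_supporting_functional H_ip e_basis l_lin l_bdd.
have [Y [sY lawY]] := X_series hb.
exists s, Y; split=> // [F mF|]; first by rewrite lawY.
apply: filterS (as_sum_functional db sY) => w bY.
rewrite -(cvg_lim _ bY)//; apply/cvg_lim => //; apply: cvg_near_cst.
exists 1%N => // n /= n0; rewrite /series/= big_mkord.
have blh i : b (u (h i)) = s * (i == 0%N)%:R by exact: lh.
rewrite (bigD1 (Ordinal n0))//= blh eqxx mulr1 big1 ?addr0 1?mulrC// => i i0.
by rewrite blh (_ : (i == 0%N :> nat) = false) ?mulr0//; exact: negbTE i0.
Qed.

Lemma functional_law b : dualSpace (contFun T) b ->
  exists2 s : R, 0 <= s & forall B, measurable B ->
    P ((b \o X) @^-1` B) = P' ((fun w => s * om 0 w) @^-1` B).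
Proof.
move=> db; have [s [Y [s0 lawY bY]]] := functional_series db.
exists s => // B mB; have mb := measurable_dual db.
have mbB : measurable (b @^-1` B) by rewrite -[X in measurable X]setTI; exact: mb.
rewrite comp_preimage -[LHS]/(distribution P X (b @^-1` B)) lawY//.
apply: (@ae_eq_probability _ _ _ P' (Y @^-1` (b @^-1` B))).
- by rewrite -[X in measurable X]setTI; exact: measurable_funP.
- rewrite -[X in measurable X]setTI.
  have : measurable_fun setT (fun w => s * om 0 w) by exact: measurable_funM.
  exact.
by apply: filterS bY => w /= ->.
Qed.

Lemma functional_gaussian b : dualSpace (contFun T) b ->
  gaussian_rv P (b \o X).
Proof.
move=> db; split; first exact: measurableT_comp (measurable_dual db) _.
have [s s0 law] := functional_law db.
exists 0, s => B mB; rewrite law// /gaussian_prob.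
(* For [s = 0] the functional is almost surely 0 and its law is the Dirac mass at 0. *)
case: eqVneq => [->|sn0].
  rewrite /dirac indicE; have [B0|B0] := boolP (0 \in B).
    rewrite [X in P' X](_ : _ = setT) ?probability_setT//.
    by apply/seteqP; split => w //= _; rewrite mul0r; exact: set_mem.
  rewrite [X in P' X](_ : _ = set0) ?measure0//.
  by apply/seteqP; split => w //=; rewrite mul0r => /mem_set; rewrite (negbTE B0).
have sp : 0 < s by rewrite lt_def sn0.
rewrite -normal_prob_scale// -(om_iid.2 0%N)//.
rewrite -[X in measurable X]setTI.
have : measurable_fun setT (fun x : R => s * x) by exact: measurable_funM.
exact.
Qed.

(** The functional has the law of a multiple of a standard normal variable, so the first moment of
    the normal law suffices. *)
Lemma functional_integrable b : dualSpace (contFun T) b ->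
  P.-integrable setT (EFin \o (b \o X)).
Proof.
move=> db; have [s s0 law] := functional_law db.
have mbX : measurable_fun setT (b \o X).
  exact: measurableT_comp (measurable_dual db) _.
have mso : measurable_fun setT (fun w => s * om 0 w) by exact: measurable_funM.
pose bX : {mfun Omega >-> R} := mfun_Sub (mem_set mbX).
pose so : {mfun Omega' >-> R} := mfun_Sub (mem_set mso).
apply: (@same_law_integrable _ _ _ _ _ _ _ P P' bX so law idfun); first exact: measurable_id.
rewrite [X in integrable _ _ X](_ : _ = fun w => (s%:E * (om 0 w)%:E)%E); last first.
  by apply/funext => w.
apply: integrableZl => //.
have nid := @integrable_normal_id R.
move/integrableP : nid => [_ nid]; apply/integrableP; split.
  exact/measurable_EFinP.
rewrite -[X in (X < _)%E](@ge0_integral_distribution _ _ _ _ _ P' (om 0%N)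
  (fun x => `|x%:E|%E))//; last first.
  by apply: measurableT_comp => //; exact/measurable_EFinP.
(* The normal law lives on [measurableTypeR R] and [om 0] takes values in [R]; pushing forward by
   the identity passes between these two copies of the Borel line. *)
have mid : @measurable_fun _ _ (measurableTypeR R) R setT id.
  by move=> _ B mB; rewrite setTI.
have mabs : measurable_fun setT (fun x : R => `|x%:E|%E).
  by apply: measurableT_comp => //; exact/measurable_EFinP.
have nidE := ge0_integral_pushforward mid (normal_prob (0 : R) 1) measurableT
  mabs (fun y _ => abse_ge0 y%:E).
apply: le_lt_trans nid.
rewrite le_eqVlt; apply/orP; left; apply/eqP; rewrite -[RHS]nidE.
by apply: eq_measure_integral => B mB _; exact: om_iid.2.
Qed.

End gaussian_functionals.

(** * The conditioned series *)

Section shifted_series.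
Context {R : realType} {T : R} {d : measure_display} {W : measurableType d}.
Variables (P : probability W R) (om : nat -> {mfun W >-> R}).
Hypothesis om_iid : iid_standard_normal P om.

Lemma iid_shift_law k (E : set (@seqSpace R)) : measurable E ->
  P [set w | E (om^~ w)] = P [set w | E (fun i => om (k + i)%N w)].
Proof.
have [om_ind om_law] := om_iid.
apply: (@independent_rvs_law _ _ _ P om (fun i => om (k + i)%N)) => //.
  exact: (@independent_rvs_shift _ _ _ P (fun i => om i) k om_ind).
by move=> i B mB; exact: etrans (om_law i B mB) (esym (om_law (k + i)%N B mB)).
Qed.

(** Both sums are images under [series_lim v] of coefficient sequences with the same law.
    Convergence is itself a measurable event of the sequence, so its probability 1 carries over from
    the shifted variables to [om]. *)
Lemma shifted_as_sum k (v : nat -> contFun T) (Y0 : W -> contFun T) :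
  as_sum P (fun i => om (k + i)%N) v Y0 ->
  exists Y Y' : {mfun W >-> contFun T},
    [/\ as_sum P om v Y, as_sum P (fun i => om (k + i)%N) v Y' &
    forall F : set (contFun T), measurable F ->
      distribution P Y F = distribution P Y' F].
Proof.
move=> sY0.
have mY := measurable_series_lim v (fun i => measurable_funPT (om i)).
have mY' := measurable_series_lim v (fun i => measurable_funPT (om (k + i)%N)).
pose Y : {mfun W >-> contFun T} := mfun_Sub (mem_set mY).
pose Y' : {mfun W >-> contFun T} := mfun_Sub (mem_set mY').
pose C : set (@seqSpace R) := [set x | cvgn (series (fun i => x i *: v i))].
have mC : measurable C := measurable_cvg_series v (@measurable_coord R).
have mCk (z : nat -> {mfun W >-> R}) : measurable [set w | C (z^~ w)].
  exact: measurable_cvg_series v (fun i => measurable_funPT (z i)).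
have limE x : C x -> series (fun i => x i *: v i) @ \oo --> series_lim v x.
  by rewrite /series_lim => Cx; rewrite asboolT.
have C1 : P [set w | C (fun i => om (k + i)%N w)] = 1%E.
  rewrite -(@probability_setT _ _ _ P); apply: ae_eq_probability => //.
  by apply: filterS sY0 => w cw; split=> // _; apply/cvg_ex; exists (Y0 w).
have C2 : P [set w | C (om^~ w)] = 1%E by rewrite (iid_shift_law k).
have aeC (z : nat -> {mfun W >-> R}) : P [set w | C (z^~ w)] = 1%E ->
    {ae P, forall w, C (z^~ w)}.
  move=> z1; exists (~` [set w | C (z^~ w)]); split => //.
  - by apply: measurableC; exact: mCk.
  - by rewrite probability_setC// z1 subee.
exists Y, Y'; split=> [||F mF].
- by apply: filterS (aeC om C2) => w; exact: limE.
- by apply: filterS (aeC (fun i => om (k + i)%N) C1) => w; exact: limE.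
apply: (@iid_shift_law k [set x | F (series_lim v x)]).
rewrite -[X in measurable X]setTI.
exact: (measurable_series_lim v (@measurable_coord R) measurableT mF).
Qed.

End shifted_series.

Lemma flip_basis {R : realType} {H : completeNormedModType R} {ip : H -> H -> R}
    (H_ip : inner_product ip) k (h : nat -> H) :
  orthonormal_basis ip setT h ->
  orthonormal_basis ip setT (fun i => if (i < k)%N then h i else - h i).
Proof.
move=> /(orthonormal_basisP H_ip)[oh th]; apply/(orthonormal_basisP H_ip).
split=> [i j|x hx]; last first.
  by apply: th => i; have := hx i; case: ifP => // _; rewrite ipNl// => /eqP; rewrite oppr_eq0 => /eqP.
have [->|ij] := eqVneq i j.
  by case: ifP => _; rewrite ?(ipNl H_ip) ?(ipNr H_ip) ?opprK oh eqxx.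
by case: ifP => _; case: ifP => _;
  rewrite ?(ipNl H_ip) ?(ipNr H_ip) oh (negbTE ij) ?opprK ?oppr0.
Qed.

(** The sets of this form are a sigma-algebra containing the generators. The invariance clause says
    that [F] sees a function only through the values of the conditions, so that modifications
    preserving these values preserve [F]. *)
Lemma conditions_sigma_preimage {R : realType} {T : R} {d : measure_display}
    {Omega : measurableType d} (X : {mfun Omega >-> contFun T})
    (A : set (contFun T -> R)) (S : set Omega) : A `<=` dualSpace _ ->
  conditions_sigma A X S ->
  exists F : set (contFun T), [/\ measurable F,
    forall x y, (forall a, A a -> a x = a y) -> F x -> F y & S = X @^-1` F].
Proof.
move=> dA; pose Q S F := [/\ measurable F, forall x y,
  (forall a, A a -> a x = a y) -> F x -> F y & S = X @^-1` F].
suff sub : conditions_sigma A X `<=` [set S | exists F, Q S F] by exact: sub.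
apply: smallest_sub; last first.
  move=> _ [a Aa [B mB <-]]; exists (a @^-1` B); split.
  - by rewrite -[X in measurable X]setTI; exact: (measurable_dual (dA _ Aa)).
  - by move=> x y /(_ a Aa) /= ->.
  - by rewrite setTI.
split.
- by exists set0; split.
- move=> E [F [mF iF ->]]; exists (~` F); split; first exact: measurableC.
    by move=> x y xy nFx /(iF y x (fun a Aa => esym (xy a Aa))).
  by rewrite setTD.
- move=> E /choice[F QF]; exists (\bigcup_i F i); split.
  + by apply: bigcupT_measurable => i; have [] := QF i.
  + move=> x y xy [i _ Fx]; exists i => //.
    by have [_ iF _] := QF i; exact: iF xy Fx.
  + rewrite preimage_bigcup; apply: eq_bigcupr => i _.
    by have [] := QF i.
Qed.

(** * Orthogonality of residual functionals to the conditions *)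

Section orthogonality.
Context {R : realType} {T : R}.
Context {d : measure_display} {Omega : measurableType d} (P : probability Omega R).
Variable X : {mfun Omega >-> contFun T}.
Context {H : completeNormedModType R} {ip : H -> H -> R}.
Hypothesis H_ip : inner_product ip.
Variable u : {linear H -> contFun T}.
Context {d' : measure_display} {Omega' : measurableType d'}
  (P' : probability Omega' R).
Variable om : nat -> {mfun Omega' >-> R}.
Hypothesis X_series : forall h : nat -> H, orthonormal_basis ip setT h ->
    exists Y : {mfun Omega' >-> contFun T},
      as_sum P' om (u \o h) Y /\
      forall F : set (contFun T), measurable F ->
        distribution P' Y F = distribution P X F.

(* Replacing [h i] by [- h i] for [i >= k] yields another representation of the
   law of [X], in which the conditions keep their values while [c] changes
   sign. *)
Lemma integral_orthogonal k (h : nat -> H) p (a : 'I_p -> contFun T -> R)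
    (c : contFun T -> R) (F : set (contFun T)) :
  orthonormal_basis ip setT h ->
  (forall i, dualSpace (contFun T) (a i)) -> dualSpace (contFun T) c ->
  (forall i j, a i (u (h (k + j)%N)) = 0) ->
  (forall j, (j < k)%N -> c (u (h j)) = 0) ->
  measurable F -> (forall x y, (forall i, a i x = a i y) -> F x -> F y) ->
  P.-integrable setT (EFin \o (c \o X)) ->
  (\int[P]_(w in X @^-1` F) (c (X w))%:E = 0)%E.
Proof.
move=> hb da dc akj cj mF iF intc.
have mc := measurable_dual dc.
have [Y1 [s1 law1]] := X_series hb.
have [Y2 [s2 law2]] := X_series (flip_basis H_ip k hb).
have intY (Y : {mfun Omega' >-> contFun T}) : (forall F : set (contFun T),
    measurable F -> distribution P' Y F = distribution P X F) ->
    P'.-integrable setT (EFin \o (c \o Y)).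
  by move=> lawY; exact: (same_law_integrable lawY mc intc).
have IY (Y : {mfun Omega' >-> contFun T}) : (forall F : set (contFun T),
    measurable F -> distribution P' Y F = distribution P X F) ->
    (\int[P]_(w in X @^-1` F) (c (X w))%:E =
     \int[P']_(w in Y @^-1` F) (c (Y w))%:E)%E.
  by move=> lawY; exact: (esym (same_law_integral lawY mc intc mF)).
have mY (Y : {mfun Omega' >-> contFun T}) : measurable (Y @^-1` F).
  by rewrite -[X in measurable X]setTI; exact: measurable_funP.
have mcY (Y : {mfun Omega' >-> contFun T}) :
    measurable_fun setT (EFin \o (c \o Y)).
  by apply/measurable_EFinP; exact: measurableT_comp.
(* The terms whose sign is flipped are those on which the conditions vanish. *)
have aY : {ae P', forall w, forall i, a i (Y1 w) = a i (Y2 w)}.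
  apply: filter_forall => i.
  apply: (as_sum_functional_eq (da i) (da i) s1 s2) => w L.
  rewrite (_ : (fun j => _) = (fun j => om j w * a i ((u \o h) j)))//.
  apply/funext => j /=; case: ifPn => //; rewrite -leqNgt => kj.
  by rewrite linearN (dualN (da i)) -(subnKC kj) akj oppr0.
have dNc : dualSpace (contFun T) (fun x => - c x).
  case: dc => lc cc; split=> [r x y|x]; first by rewrite lc; ring.
  by apply: (@continuousN R R (contFun T)); exact: cc.
(* All terms seen by [c] have their sign flipped, the first [k] contributing 0. *)
have cY : {ae P', forall w, c (Y2 w) = - c (Y1 w)}.
  apply: (as_sum_functional_eq dc dNc s2 s1) => w L.
  rewrite (_ : (fun j => _) = (fun j => om j w * - c ((u \o h) j)))//.
  apply/funext => j /=; case: ifPn => jk; first by rewrite cj// oppr0.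
  by rewrite linearN (dualN dc).
set I := LHS.
have I1 : I = (\int[P']_(w in Y1 @^-1` F) (c (Y1 w))%:E)%E by exact: IY.
(* Computed with [Y2], the event is almost surely the same and the integrand has the opposite
   sign. *)
have I2 : I = (- \int[P']_(w in Y1 @^-1` F) (c (Y1 w))%:E)%E.
  rewrite -integralN/=; last first.
    apply: integrable_add_def => //.
    exact: (integrableS measurableT (mY Y1) (@subsetT _ _) (intY _ law1)).
  rewrite /I (IY Y2)// integral_mkcond [RHS]integral_mkcond.
  apply: ae_eq_integral => //.
  - by apply/(measurable_restrictT _ _).1 => //; exact: measurable_funTS (mcY Y2).
  - apply/(measurable_restrictT _ _).1 => //; apply: measurable_funTS.
    apply/measurable_EFinP; apply: measurableT_comp => //.
    exact: (measurableT_comp mc (measurable_funPT Y1)).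
  apply: filterS2 aY cY => w aw cw _; rewrite /patch.
  have -> : (w \in Y2 @^-1` F) = (w \in Y1 @^-1` F).
    by apply/idP/idP; rewrite !inE; apply: iF.
  by case: ifP => // _; rewrite cw.
(* In the extended reals [I = - I] forces [I = 0] once [I] is defined and finite, which
   integrability provides. *)
have If : I \is a fin_num.
  rewrite I1; apply: integrable_fin_num => //.
  exact: (integrableS measurableT (mY Y1) (@subsetT _ _) (intY _ law1)).
move: I2; rewrite -I1 -(fineK If) -EFinN => -[] r2.
by congr EFin; lra.
Qed.

End orthogonality.

(** * Identification of the law of the conditioned series *)

Unset Implicit Arguments.

Theorem theorem2p2 (R : realType) (T : R) (T_gt0 : 0 < T)
  (d : measure_display) (Omega : measurableType d) (P : probability Omega R)
  (X : {mfun Omega >-> contFun T})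
  (X_gauss : gaussian_process P X) (X_centered : centered_process P X)
  (A : set (contFun T -> R)) (A_fin : finite_set A)
  (A_dual : A `<=` dualSpace (contFun T))
  (H : completeNormedModType R) (ip : H -> H -> R) (H_ip : inner_product ip)
  (H_sep : separable H)
  (u : {linear H -> contFun T}) (u_bdd : bounded_operator u)
  (d' : measure_display) (Omega' : measurableType d')
  (P' : probability Omega' R)
  (om : nat -> {mfun Omega' >-> R}) (om_iid : iid_standard_normal P' om)
  (X_series : forall h : nat -> H, orthonormal_basis ip setT h ->
    exists Y : {mfun Omega' >-> contFun T},
      as_sum P' om (u \o h) Y /\
      forall F : set (contFun T), measurable F ->
        distribution P' Y F = distribution P X F)
  (f : nat -> H)
  (f_basis : orthonormal_basis ip (conditioned_subspace u A) f) :
  exists Y : {mfun Omega' >-> contFun T},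
    as_sum P' om (u \o f) Y /\ conditioned_process P P' X A Y.
Proof.
have [s As] := (finite_seqP A).1 A_fin.
pose a (i : 'I_(size s)) : contFun T -> R := nth (fun _ => 0) s i.
have Aa i : A (a i) by rewrite As /= mem_nth.
have aA b : A b -> exists i, a i = b.
  rewrite As /= => bs; rewrite -index_mem in bs.
  by exists (Ordinal bs); rewrite /a nth_index// -index_mem.
have da i : dualSpace (contFun T) (a i) by exact: A_dual.
have l_lin i : scalar (a i \o u).
  by case: (da i) => la _ c x y; rewrite /= linearP la.
have f_basis' : orthonormal_basis ip [set x | forall i, (a i \o u) x = 0] f.
  rewrite (_ : [set x | _] = conditioned_subspace u A)//.
  apply/seteqP; split => x /= xA; first by move=> b /aA[i <-]; exact: xA.
  by move=> i; exact: xA.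
have [k [h [hb hk lam]]] := complete_kernel_basis H_ip l_lin f_basis'.
have [lm lmP] := choice lam.
have akj i j : a i (u (h (k + j)%N)) = 0.
  by rewrite hk; case: f_basis => fV _ _; exact: fV.
(* [z b] is the combination of conditions matching [b] on the first [k] basis vectors, and [c b] the
   residual; [z b] will give the conditional expectation. *)
pose z (b : contFun T -> R) x := \sum_i lm (b \o u) i * a i x.
pose c (b : contFun T -> R) x := b x - z b x.
have dz b : dualSpace (contFun T) (z b) by exact: dual_sum.
have dc b : dualSpace (contFun T) b -> dualSpace (contFun T) (c b).
  by move=> db; exact: dualB.
have c0 b j : (j < k)%N -> c b (u (h j)) = 0.
  by move=> jk; rewrite /c -[b _]/((b \o u) (h j)) lmP// subrr.
have ck b j : c b (u (h (k + j)%N)) = b (u (f j)).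
  by rewrite /c /z big1 ?subr0 ?hk// => i _; rewrite -hk akj mulr0.
have [Yh [sYh lawYh]] := X_series h hb.
(* Removing the first [k] terms from the series for [Yh] leaves the series over [f], driven by the
   shifted variables. *)
have sY0 : as_sum P' (fun i => om (k + i)%N) (u \o f)
    (fun w => Yh w - series (fun i => om i w *: (u \o h) i) k).
  apply: filterS sYh => w cw.
  rewrite (_ : series (fun i => om (k + i)%N w *: (u \o f) i) =
    (fun n => series (fun i => om i w *: (u \o h) i) (n + k)%N
    - series (fun i => om i w *: (u \o h) i) k)); last first.
    apply/funext => n; rewrite series_add addrC addKr; congr (series _ n).
    by apply/funext => i /=; rewrite hk.
  by apply: cvgB; [rewrite (cvg_shiftn k)|exact: cvg_cst].
(* [Y] is the required process; [Y'] has the same law and is almost surely the tail of [Yh], which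
   ties it to a copy of [X]. *)
have [Y [Y' [sY sY' lawYY']]] := shifted_as_sum om_iid sY0.
(* The residual kills the first [k] terms of [Yh] and acts as [b] on the tail. *)
have cY b : dualSpace (contFun T) b -> {ae P', forall w, c b (Yh w) = b (Y' w)}.
  move=> db; apply: (as_sum_functional_eq (dc b db) db sYh sY') => w L.
  rewrite -(cvg_shiftn k).
  suff -> : [sequence series (fun i => om i w * c b ((u \o h) i)) (n + k)%N]_n =
    series (fun i => om (k + i)%N w * b ((u \o f) i)) by [].
  apply/funext => n /=; rewrite series_add [X in X + _]/series/= big_nat big1 => [|i /= ik].
    by rewrite add0r; congr (series _ n); apply/funext => i; rewrite ck.
  by rewrite c0// mulr0.
(* Events pass from [Y] to [Y'] by equality in law, from [Y'] to [Yh] almost surely, and from [Yh]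
   to [X] by equality in law. *)
have transfer G G' : measurable G -> measurable G' ->
    {ae P', forall w, G (Y' w) <-> G' (Yh w)} -> P' (Y @^-1` G) = P (X @^-1` G').
  move=> mG mG' GG'; rewrite -[LHS]/(distribution P' Y G) lawYY'//.
  rewrite -[RHS]/(distribution P X G') -lawYh//.
  apply: (@ae_eq_probability _ _ _ P' (Y' @^-1` G) (Yh @^-1` G')) => //.
  - by rewrite -[X in measurable X]setTI; exact: measurable_funP.
  - by rewrite -[X in measurable X]setTI; exact: measurable_funP.
have intX b : dualSpace (contFun T) b -> P.-integrable setT (EFin \o (b \o X)).
  exact: (functional_integrable H_ip u_bdd om_iid X_series hb).
exists Y; split=> //; split.
  (* A linear combination of values of [Y] has the law of the residual functional [c b] of [X],
     which is Gaussian. *)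
  move=> n t co; pose b (x : contFun T) := \sum_i co i * x (t i).
  have db : dualSpace (contFun T) b by apply: dual_sum => i; exact: dual_eval.
  have mb := measurable_dual db; have mcb := measurable_dual (dc b db).
  split; first exact: (measurableT_comp mb (measurable_funPT Y)).
  have [_ [m [r law]]] :=
    functional_gaussian H_ip u_bdd om_iid X_series hb (dc b db).
  exists m, r => B mB; rewrite -law//.
  apply: (transfer (b @^-1` B) (c b @^-1` B)).
  - by rewrite -[X in measurable X]setTI; exact: mb.
  - by rewrite -[X in measurable X]setTI; exact: mcb.
  - by apply: filterS (cY b db) => w /= ->.
move=> n b db; exists (fun i => z (b i) \o X); split.
  move=> i; split; [exact: intX|exact: intX| |].
    move=> B mB.
    pose G := \bigcup_(a0 in A) preimage_set_system setT (a0 \o X)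
                         (measurable : set (set R)).
    have mz : @measurable_fun _ _ (g_sigma_algebraType G) R setT (z (b i) \o X).
      apply: measurable_sum => j; apply: measurable_funM => //.
      move=> _ C mC; apply: sub_sigma_algebra; exists (a j) => //.
      by exists C.
    by have := mz measurableT B mB; rewrite setTI.
  (* Over an event of the conditions the residual integrates to 0, so [b i] and [z (b i)] have the
     same integral. *)
  move=> S /(conditions_sigma_preimage A_dual)[F [mF iF ->]].
  have mXF : measurable (X @^-1` F).
    by rewrite -[X in measurable X]setTI; exact: measurable_funP.
  have intF b0 : dualSpace (contFun T) b0 ->
      P.-integrable (X @^-1` F) (EFin \o (b0 \o X)).
    by move=> db0; exact: (integrableS measurableT mXF (@subsetT _ _) (intX _ db0)).
  have bE w : ((b i \o X) w)%:E = (((z (b i) \o X) w)%:E + ((c (b i) \o X) w)%:E)%E.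
    by rewrite -EFinD /= /c addrC subrK.
  under [RHS]eq_integral do rewrite bE.
  rewrite integralD//; [|exact: (intF _ (dz (b i)))|exact: (intF _ (dc _ (db i)))].
  rewrite (integral_orthogonal H_ip X_series hb da (dc _ (db i)) akj (@c0 (b i)) mF)
    ?adde0//.
  - by move=> x y xy; apply: iF => a0 /aA[j <-].
  - exact: (intX _ (dc _ (db i))).
move=> B mB.
have mt (g : 'I_n -> contFun T -> R) : (forall i, dualSpace (contFun T) (g i)) ->
    measurable [set x | B [tuple g i x | i < n]].
  move=> dg; rewrite -[X in measurable X]setTI.
  have : measurable_fun setT (fun x : contFun T => [tuple g i x | i < n]).
    apply/measurable_fun_tnthP => i.
    rewrite (_ : _ \o _ = g i); first exact: measurable_dual.
    by apply/funext => x /=; rewrite tnth_mktuple.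
  exact.
(* The differences on the side of [X] are by definition the residuals [c (b i)], matched with [b i]
   of [Y'] simultaneously for the finitely many [i]. *)
apply: (transfer _ [set x | B [tuple c (b i) x | i < n]]).
- exact: mt.
- by apply: mt => i; exact: dc.
have : {ae P', forall w, forall i, c (b i) (Yh w) = b i (Y' w)}.
  by apply: filter_forall => i; exact: cY.
apply: filterS => w cbY /=.
by rewrite (_ : [tuple c _ _ | _ < n] = [tuple b i (Y' w) | i < n])//;
  apply: eq_from_tnth => i; rewrite !tnth_mktuple.
Qed.
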